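(* Let $s,k\ge 1$ be integers. The following are equinumerous: 1. the number of $(s,s+1,\dots,s+k)$-cores; 2. the number of $(s,k)$ generalized Dyck paths; 3. the number of lower ideals in $P_{\{s,s+1,\dots,s+k\}}$.
   Context: Cores: the hook length of a cell $c$ in the (French) Ferrers diagram of a partition $\lambda$ is the number of cells directly north or directly east of $c$, including $c$ itself. For a positive integer $t$, $\lambda$ is a $t$-core if its diagram contains no cell whose hook length is divisible by $t$. An $(s,s+1,\dots,s+k)$-core is a partition (of any size, including the empty partition) that is simultaneously a $t$-core for each $t\in\{s,s+1,\dots,s+k\}$. Generalized Dyck paths: an $(s,k)$ generalized Dyck path is a lattice path in the $s\times s$ square from $(0,0)$ to $(s,s)$, regarded as a sequence of steps, that stays weakly above the line $y=x$ and consists of vertical steps $N_k=(0,k)$, horizontal steps $E_k=(k,0)$, and diagonal steps $D_i=(i,i)$ for $1\le i\le k-1$. Posets: for a set $S$ of positive integers, $P_S$ is the set of positive integers that cannot be written as a non-negative integer linear combination of elements of $S$, with the partial order generated by declaring $a$ above $b$ whenever $a-b\in S$ (equivalently, $b\le a$ in $P_S$ iff $a-b$ is a non-negative integer linear combination of elements of $S$). A lower ideal of a poset $P$ is a subset $I\subseteq P$ such that $a<_P b$ and $b\in I$ imply $a\in I$ (the empty set is allowed). *)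

(* Defs.v *)
From Stdlib Require Import Relation_Operators.
From mathcomp Require Import all_boot.
From mathcomp Require Import boolp classical_sets cardinality.

Set Implicit Arguments.
Unset Strict Implicit.
Unset Printing Implicit Defensive.

Local Open Scope classical_set_scope.

(* A partition is the weakly decreasing list of its (positive) parts; the
   empty partition is [::]. *)
Definition is_partition (la : seq nat) : Prop :=
  sorted geq la /\ 0 \notin la.

(* French convention: row y (counted from the bottom) consists of the cells
   (x, y) with x < nth 0 la y, so north increases y and east increases x. *)
Definition cells (la : seq nat) : seq (nat * nat) :=
  [seq (x, y) | y <- iota 0 (size la), x <- iota 0 (nth 0 la y)].

Definition hook_length (la : seq nat) (c : nat * nat) : nat :=
  count (fun d => ((d.1 == c.1) && (c.2 <= d.2)) ||
                  ((d.2 == c.2) && (c.1 <= d.1))) (cells la).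

Definition is_core (t : nat) (la : seq nat) : Prop :=
  forall c, c \in cells la -> ~~ (t %| hook_length la c).

Definition simultaneous_cores (S : set nat) : set (seq nat) :=
  [set la | is_partition la /\ forall t, S t -> is_core t la].

(* Steps are displacement vectors. For k >= 1 the vectors N_k, E_k and
   D_1, ..., D_(k-1) are pairwise distinct, so lists of vectors are the same
   as sequences of steps. *)
Definition gdyck_step (k : nat) (v : nat * nat) : Prop :=
  [\/ v = (0, k), v = (k, 0) | exists2 i, 0 < i < k & v = (i, i)].

Definition translate (p v : nat * nat) : nat * nat := (p.1 + v.1, p.2 + v.2).

(* The points reached after each step, starting from (0, 0). *)
Definition vertices (w : seq (nat * nat)) : seq (nat * nat) :=
  scanl translate (0, 0) w.

(* Since the square and the half-plane x <= y are convex, a path stays in them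
   if and only if its vertices do. *)
Definition gdyck_paths (s k : nat) : set (seq (nat * nat)) :=
  [set w | [/\ forall v, v \in w -> gdyck_step k v,
               forall q, q \in vertices w -> q.1 <= q.2 <= s
             & last (0, 0) (vertices w) = (s, s)]].

Definition nat_combination (S : set nat) (n : nat) : Prop :=
  exists (r : seq nat) (c : nat -> nat),
    (forall t, t \in r -> S t) /\ n = \sum_(t <- r) c t * t.

Definition gap_poset (S : set nat) : set nat :=
  [set n | 0 < n /\ ~ nat_combination S n].

(* gap_above S b a: a is declared above b in P_S. *)
Definition gap_above (S : set nat) (b a : nat) : Prop :=
  [/\ gap_poset S b, gap_poset S a, b <= a & S (a - b)].

Definition gap_le (S : set nat) : nat -> nat -> Prop :=
  clos_refl_trans nat (gap_above S).

Definition gap_lt (S : set nat) (a b : nat) : Prop := gap_le S a b /\ a <> b.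

Definition lower_ideals (S : set nat) : set (set nat) :=
  [set I | I `<=` gap_poset S /\ forall a b, gap_lt S a b -> I b -> I a].

(* Main.v *)
(* Let S = {s, ..., s+k}. A lower ideal of P_S is the same as a set I of natural
   numbers that avoids 0 and is closed under subtracting elements of S.

   Cores: send a partition to the set B of its first-column hook lengths. The
   hook lengths in the row of b in B are the numbers b - j with j < b and j not in
   B, so the partition is a t-core if and only if B avoids 0 and is closed under
   subtracting t.

   Paths: writing the elements of I as m * s + r with r < s, closure under s means
   that, for fixed r, they are those with m < h_r. Thus I is a word h_0 ... h_(s-1),
   and closure under S says that h_0 = 0 and h_i <= h_j + 1 for j <= i <= j + k.
   A path is encoded by such a word through its level (y - x) / k: a step of rise
   i > 0 from level l writes l followed by i - 1 letters l + 1, and E_k writes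
   nothing. To read the path back from level l, take E_k if the next letter is
   below l (or missing); otherwise it is l, and the rise is one plus the number of
   letters above l that follow it, capped at k. *)

Require Import Defs.
From Stdlib Require Import Relation_Operators.
From mathcomp Require Import all_boot zify.
From mathcomp Require Import boolp classical_sets cardinality.

Set Implicit Arguments.
Unset Strict Implicit.
Unset Printing Implicit Defensive.

Local Open Scope classical_set_scope.
Local Open Scope card_scope.

(** * Subtraction-closed sets and height words *)

Definition sub_closed (S : set nat) : set (set nat) :=
  [set I | ~ I 0 /\ forall b t, I b -> S t -> t <= b -> I (b - t)].

Lemma sub_closed_mul (S I : set nat) (t c x : nat) :
  sub_closed S I -> S t -> I (x + c * t) -> I x.
Proof.
move=> [_ clI] St; elim: c x => [|c IHc] x; first by rewrite mul0n addn0.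
move=> Ix; apply: IHc; have := clI _ _ Ix St; rewrite mulSn addnCA addKn.
by apply; apply: leq_addr.
Qed.

Lemma sub_closed_nat_combination (S I : set nat) (n : nat) :
  sub_closed S I -> nat_combination S n -> ~ I n.
Proof.
move=> clI [r [c [rS ->]]].
(* With a remainder [x], the terms of the sum can be removed one by one; [x = 0] then leads to the
   excluded 0. *)
suff clIr x : I (x + \sum_(t <- r) c t * t) -> I x.
  by rewrite -[X in I X]add0n => /clIr/clI.1.
elim: r rS x => [|t r IHr] rS x; first by rewrite big_nil addn0.
rewrite big_cons addnA addnAC => Ix; apply: IHr => [t' rt'|].
  by apply: rS; rewrite inE rt' orbT.
by apply: sub_closed_mul clI (rS t _) Ix; rewrite inE eqxx.
Qed.

(* The list of generators in [nat_combination] may repeat a generator, with the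
   same coefficient each time; hence the passage to a duplicate-free list. *)
Lemma sum_uniq_coefficients (r r' : seq nat) (c : nat -> nat) :
  uniq r' -> {subset r <= r'} ->
  exists d : nat -> nat, \sum_(t <- r) c t * t = \sum_(t <- r') d t * t.
Proof.
move=> uniq_r'; elim: r => [|t r IHr] rr'.
  by exists (fun=> 0); rewrite big_nil big1.
have [|d dE] := IHr; first by move=> u ru; apply: rr'; rewrite inE ru orbT.
have r't : t \in r' by apply: rr'; rewrite inE eqxx.
exists (fun u => d u + (u == t) * c t).
rewrite big_cons dE; under [in RHS]eq_bigr do rewrite mulnDl.
rewrite big_split /= addnC; congr (_ + _).
rewrite (bigD1_seq t) //= eqxx mul1n big1 ?addn0 // => u /negPf ->.
by rewrite !mul0n.
Qed.

Lemma nat_combinationD (S : set nat) (n t : nat) :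
  nat_combination S n -> S t -> nat_combination S (n + t).
Proof.
move=> [r [c [rS ->]]] St; pose r' := undup (t :: r).
have [||d dE] := @sum_uniq_coefficients r r' c; first exact: undup_uniq.
  by move=> u ru; rewrite mem_undup inE ru orbT.
exists r', (fun u => d u + (u == t)); split=> [u|].
  by rewrite mem_undup inE => /predU1P[->|/rS].
rewrite dE; under [in RHS]eq_bigr do rewrite mulnDl.
rewrite big_split /=; congr (_ + _).
rewrite (bigD1_seq t) ?undup_uniq ?mem_undup ?inE ?eqxx //= mul1n.
by rewrite big1 ?addn0 // => u /negPf ->.
Qed.

(** A gap minus a generator is again a gap, since otherwise adding the generator back would make the
    gap a combination. Conversely, [sub_closed] sets contain only gaps. *)
Lemma lower_ideals_sub_closed (S : set nat) :
  ~ S 0 -> lower_ideals S = sub_closed S.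
Proof.
move=> S0; apply/seteqP; split=> I.
  move=> [Igap lowI]; split=> [/Igap[]//|b t Ib St tb].
  have [b_gt0 bNcomb] := Igap b Ib.
  have gap_bt : gap_poset S (b - t).
    split; last first.
      by move=> /nat_combinationD/(_ St); rewrite subnK.
    rewrite lt0n; apply/eqP => bt0; apply: bNcomb.
    exists [:: t], (fun=> 1); split=> [u|]; first by rewrite inE => /eqP ->.
    by rewrite big_seq1 mul1n; lia.
  have t_gt0 : 0 < t by case: t St {tb gap_bt}.
  apply: lowI (Ib); split; last by lia.
  by apply: rt_step; split=> //; [exact: leq_subr|rewrite subKn].
move=> clI; split=> [b Ib|a b [leab _]].
  split; last by move/(sub_closed_nat_combination clI); apply.
  by rewrite lt0n; apply/eqP => b0; apply: clI.1; rewrite -b0.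
elim: leab => {a b} [a b [_ _ ab Sba] Ib|//|a b c _ IHab _ IHbc Ic].
  by rewrite -(subKn ab); apply: clI.2 => //; apply: leq_subr.
by apply/IHab/IHbc.
Qed.

Lemma sub_closed_interval_bounded (s k : nat) (I : set nat) (n : nat) :
  0 < s -> 0 < k -> sub_closed [set t | s <= t <= s + k] I ->
  I n -> n %/ s < s.
Proof.
move=> s_gt0 k_gt0 clI In; rewrite ltnNge; apply/negP => sn.
have ms : n %% s < s by rewrite ltn_mod.
(* Using [n %% s] copies of [s + 1] produces the remainder; [s <= n %/ s] keeps the number of copies
   of [s] non-negative. *)
have nE : n = 0 + (n %/ s - n %% s) * s + n %% s * s.+1.
  by rewrite {1}(divn_eq n s); nia.
apply: clI.1; rewrite nE in In.
have Ss : [set t | s <= t <= s + k] s by rewrite /=; lia.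
have Ss1 : [set t | s <= t <= s + k] s.+1 by rewrite /=; lia.
exact: sub_closed_mul clI Ss (sub_closed_mul clI Ss1 In).
Qed.

(* [h`_r] counts the elements of an ideal that are congruent to [r] mod [s]. *)
Definition height_words (s k : nat) : set (seq nat) :=
  [set h | [/\ size h = s, nth 0 h 0 = 0 &
    forall i j, j <= i <= j + k -> nth 0 h i <= (nth 0 h j).+1]].

Definition ideal_of_heights (s : nat) (h : seq nat) : set nat :=
  [set n | n %/ s < nth 0 h (n %% s)].

Lemma ideal_of_heightsE (s : nat) (h : seq nat) (m r : nat) :
  r < s -> ideal_of_heights s h (m * s + r) = (m < nth 0 h r) :> Prop.
Proof.
move=> rs; rewrite /ideal_of_heights /= divnMDl ?modnMDl; last by lia.
by rewrite divn_small // modn_small // addn0.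
Qed.

Lemma ideal_of_heights_inj (s : nat) (h h' : seq nat) :
  size h = s -> size h' = s ->
  ideal_of_heights s h = ideal_of_heights s h' -> h = h'.
Proof.
move=> hs h's eqI; apply: (@eq_from_nth _ 0); first by rewrite hs.
move=> r; rewrite hs => rs.
have eqr m : (m < nth 0 h r) = (m < nth 0 h' r).
  apply/idP/idP; have := congr1 (fun I => I (m * s + r)) eqI;
    by rewrite !ideal_of_heightsE // => ->.
by have := eqr (nth 0 h r); have := eqr (nth 0 h' r); lia.
Qed.

Lemma sub_closed_ideal_of_heights (s k : nat) (h : seq nat) :
  0 < s -> height_words s k h ->
  sub_closed [set t | s <= t <= s + k] (ideal_of_heights s h).
Proof.
move=> s_gt0 [hs h0 hP]; split.
  by rewrite /ideal_of_heights /= mod0n h0.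
move=> b t; rewrite (divn_eq b s); have := ltn_pmod b s_gt0.
move: (b %/ s) (b %% s) => m r rs {b}; rewrite ideal_of_heightsE //= => mh st tb.
have [tr|rt] := ltnP (t - s) r; last first.
  (* Here [r <= k], so [h_0 = 0] forces [m = 0], and the number is [r < s <= t]. *)
  by have := hP r 0; rewrite h0; nia.
have m_gt0 : 0 < m by case: m mh tb => //; lia.
have -> : m * s + r - t = m.-1 * s + (r - (t - s)) by nia.
by rewrite ideal_of_heightsE; [have := hP r (r - (t - s)); lia|lia].
Qed.

Lemma initial_segment (P : set nat) (N : nat) :
  (forall m, P m.+1 -> P m) -> (forall m, P m -> m < N) ->
  exists c, forall m, P m <-> m < c.
Proof.
elim: N P => [|N IHN] P PS PN.
  by exists 0 => m; split=> // /PN.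
have [P0|nP0] := pselect (P 0); last first.
  exists 0 => m; split=> //; elim: m => // m IHm /PS/IHm //.
have [||c cP] := IHN (fun m => P m.+1); first by move=> m; apply: PS.
  by move=> m /PN.
by exists c.+1 => -[|m]; [split|exact: cP].
Qed.

Lemma ideal_of_heights_surj (s k : nat) (I : set nat) :
  0 < s -> 0 < k -> sub_closed [set t | s <= t <= s + k] I ->
  exists2 h, height_words s k h & ideal_of_heights s h = I.
Proof.
move=> s_gt0 k_gt0 clI.
have /choice[f fP] : forall r, exists c, r < s ->
    forall m, I (m * s + r) <-> m < c.
  move=> r; have [rs|] := ltnP r s; last by exists 0.
  have [||c cP] := @initial_segment (fun m => I (m * s + r)) s.
  - move=> m Im; have := clI.2 _ s Im; rewrite mulSn -addnA addKn /=.
    by apply; lia.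
  - move=> m /(sub_closed_interval_bounded s_gt0 k_gt0 clI).
    by rewrite divnMDl // divn_small // addn0.
  by exists c.
have nthf r : r < s -> nth 0 (mkseq f s) r = f r by move=> ?; rewrite nth_mkseq.
exists (mkseq f s).
  split=> [||i j ji]; first by rewrite size_mkseq.
    rewrite nthf //; have := fP 0 s_gt0 0; rewrite mul0n; case: (f 0) => // n.
    by move=> [_ /(_ isT)/clI.1].
  have [si|si] := leqP s i; first by rewrite nth_default // size_mkseq.
  have js : j < s by lia.
  rewrite !nthf //; case fi: (f i) => [//|[//|m]]; rewrite ltnS.
  apply/(fP j js); have := fP i si m.+1; rewrite fi ltnSn => -[_ /(_ isT)] Ii.
  (* Subtracting [s + (i - j)] moves from residue [i] to residue [j], one level lower. *)
  have -> : m * s + j = m.+1 * s + i - (s + (i - j)) by nia.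
  by apply: clI.2 Ii _ _ => /=; nia.
apply/predeqP => n; rewrite (divn_eq n s) ideal_of_heightsE ?ltn_pmod //.
by rewrite nthf ?ltn_pmod // fP // ltn_pmod.
Qed.

Lemma card_sub_closed (s k : nat) :
  0 < s -> 0 < k ->
  sub_closed [set t | s <= t <= s + k] #= height_words s k.
Proof.
move=> s_gt0 k_gt0.
have -> : sub_closed [set t | s <= t <= s + k] =
    ideal_of_heights s @` height_words s k.
  apply/seteqP; split=> [I /(ideal_of_heights_surj s_gt0 k_gt0)[h] hw <-|].
    by exists h.
  by move=> _ [h hw <-]; apply: sub_closed_ideal_of_heights.
apply: inj_card_eq => h h'; rewrite !inE => -[hs _ _] [h's _ _].
exact: ideal_of_heights_inj.
Qed.

(** As [k] is positive, letters start at 0 and grow by at most one per position, so [s] bounds them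
    all. *)
Lemma finite_height_words (s k : nat) : 0 < k -> finite_set (height_words s k).
Proof.
move=> k_gt0.
apply: (@sub_finite_set _ _ ((fun t : s.-tuple 'I_s.+1 => map val t) @` setT));
  last exact/finite_image/finite_finset.
move=> h [hs h0 hP].
have hi i : nth 0 h i <= i.
  by elim: i => [|i IHi]; [rewrite h0|have := hP i.+1 i; lia].
have hle : all (fun x => x < s.+1) h.
  by apply/(all_nthP 0) => i ih; have := hi i; lia.
have hsize : size (map (@inord s) h) == s by rewrite size_map hs.
exists (Tuple hsize) => //=; rewrite -map_comp map_id_in // => x xh /=.
by rewrite inordK // (allP hle).
Qed.

(** * Paths and height words *)

(** The free starting point serves induction on the path. [scanl] omits [p], hence the separate
    hypotheses [x + l * k <= s] below. *)
Definition gdyck_paths_from (s k : nat) (p : nat * nat) : set (seq (nat * nat)) :=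
  [set w | [/\ forall v, v \in w -> gdyck_step k v,
               forall q, q \in scanl translate p w -> q.1 <= q.2 <= s
             & last p (scanl translate p w) = (s, s)]].

Lemma gdyck_paths_from_cons (s k : nat) (p v : nat * nat) (w : seq (nat * nat)) :
  gdyck_paths_from s k p (v :: w) <->
  [/\ gdyck_step k v, (translate p v).1 <= (translate p v).2 <= s
    & gdyck_paths_from s k (translate p v) w].
Proof.
split=> [[/= stepP pathP lastP]|[stepv pv [stepP pathP lastP]]].
  split; first by apply: stepP; rewrite inE eqxx.
    by have := pathP (translate p v); rewrite inE eqxx; apply.
  split=> // [u uw|q qw]; first by apply: stepP; rewrite inE uw orbT.
  by apply: pathP; rewrite inE qw orbT.
by split=> //= u; rewrite inE => /predU1P[->|]; auto.
Qed.

(* A path at the point [(x, x + l * k)] has level [l]. A step rising from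
   ordinate [y] to [y + i] writes the letters [y, ..., y + i - 1] of the word, so
   the word of a path to [(s, s)] has length [s]. *)
Fixpoint path_word (l : nat) (w : seq (nat * nat)) : seq nat :=
  if w is v :: w' then
    if v.2 == 0 then path_word l.-1 w'
    else l :: nseq v.2.-1 l.+1 ++ path_word (if v.1 == 0 then l.+1 else l) w'
  else [::].

(** What a path may still write from level [l]: before the next letter the level can only fall. *)
Definition height_suffixes (k l : nat) : set (seq nat) :=
  [set h | nth 0 h 0 <= l /\
    forall i j, j <= i <= j + k -> nth 0 h i <= (nth 0 h j).+1].

Lemma nth_block (l i j : nat) (h : seq nat) : 0 < i ->
  nth 0 (l :: nseq i.-1 l.+1 ++ h) j =
    if j < i then (if j == 0 then l else l.+1) else nth 0 h (j - i).
Proof.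
case: i => // i _; case: j => [|j] //=; rewrite ltnS subSS nth_cat size_nseq nth_nseq.
by case: ltnP.
Qed.

Lemma height_suffixes_block (k l i : nat) (h : seq nat) :
  0 < i <= k -> height_suffixes k (l + (i == k)) h ->
  height_suffixes k l (l :: nseq i.-1 l.+1 ++ h).
Proof.
move=> /andP[i_gt0 ik] [h0 hP]; split=> // a b ba; rewrite !nth_block //.
have [ai|ia] := ltnP a i; first by case: ltnP; do ?case: eqP; lia.
have [bi|ib] := ltnP b i; last by apply: hP; lia.
(* A letter of [h] within distance [k] of the opening [l] is either the first of [h], or [i < k] and
   [h] starts with at most [l]. *)
have := hP (a - i) 0; case: eqP => b0; last by lia.
case: (a - i =P 0) => [->|]; lia.
Qed.

(* Diagonal and vertical steps are treated together as steps of rise [i]. *)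
Variant level_step_spec (k x l : nat) : nat * nat -> nat * nat -> Prop :=
  | LevelE : 0 < l ->
      level_step_spec k x l (k, 0) (x + k, x + k + l.-1 * k)
  | LevelRise i : 0 < i <= k ->
      level_step_spec k x l (if i == k then 0 else i, i)
        (x + (if i == k then 0 else i),
         x + (if i == k then 0 else i) + (l + (i == k)) * k).

Lemma gdyck_step_level (k x l : nat) (v : nat * nat) : 0 < k ->
  gdyck_step k v ->
  (translate (x, x + l * k) v).1 <= (translate (x, x + l * k) v).2 ->
  level_step_spec k x l v (translate (x, x + l * k) v).
Proof.
move=> k_gt0 [->|->|[i ik ->]]; rewrite /translate /=.
- move=> _; have := @LevelRise k x l k; rewrite eqxx k_gt0 leqnn => /(_ isT).
  by rewrite !addn0 mulnDl mul1n addnA.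
- move=> le; have l_gt0 : 0 < l by case: l le => //; lia.
  have -> : x + l * k + 0 = x + k + l.-1 * k; last exact: LevelE.
  by case: l l_gt0 {le} => // l _; rewrite mulSn /=; lia.
move=> _; have := @LevelRise k x l i; have -> : (i == k) = false by lia.
rewrite addn0 addnAC; apply; lia.
Qed.

Lemma level_after_rise (k l i : nat) : 0 < i <= k ->
  (if (if i == k then 0 else i) == 0 then l.+1 else l) = l + (i == k).
Proof. by move=> ik; case: (i =P k) => _ /=; [rewrite addn1|case: eqP; lia]. Qed.

Lemma path_word_suffix (s k x l : nat) (w : seq (nat * nat)) : 0 < k ->
  x + l * k <= s -> gdyck_paths_from s k (x, x + l * k) w ->
  size (path_word l w) = s - (x + l * k) /\ height_suffixes k l (path_word l w).
Proof.
move=> k_gt0; elim: w x l => [|v w IHw] x l.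
  by move=> xs [_ _ /= [-> _]]; split; [lia|split=> // i j _; rewrite nth_nil].
move=> xs /gdyck_paths_from_cons[stepv /andP[pv]].
case: (gdyck_step_level k_gt0 stepv pv) => [l_gt0|i ik] /= ys /IHw[//|sz hP].
  rewrite sz; split.
    by case: l l_gt0 {xs pv ys sz hP} => // l _; rewrite mulSn /=; lia.
  by split; [case: hP|case: hP]; first by lia.
have -> : (i == 0) = false by lia.
rewrite level_after_rise //.
split; last exact: height_suffixes_block.
rewrite /= size_cat size_nseq sz; case: eqP ys => [->|_]; lia.
Qed.

Lemma head_path_word (s k x l : nat) (w : seq (nat * nat)) : 0 < k ->
  x + l * k <= s -> gdyck_paths_from s k (x, x + l * k) w ->
  nth 0 (path_word l w) 0 <= l.
Proof. by move=> k_gt0 xs /path_word_suffix[]// _ []. Qed.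

(* Recovers the rise of the first step from the word of a path. *)
Definition next_rise (k l : nat) (h : seq nat) : nat :=
  if h is a :: h' then
    if a == l then (minn k.-1 (find (leq^~ l) h')).+1 else 0
  else 0.

Lemma next_rise_path_word (s k x l : nat) (v : nat * nat) (w : seq (nat * nat)) :
  0 < k -> x + l * k <= s -> gdyck_paths_from s k (x, x + l * k) (v :: w) ->
  next_rise k l (path_word l (v :: w)) = v.2.
Proof.
move=> k_gt0 xs /gdyck_paths_from_cons[stepv /andP[pv]].
case: (gdyck_step_level k_gt0 stepv pv) => [l_gt0|i ik] /= ys /head_path_word-/(_ k_gt0 ys).
  by case: (path_word _ w) => [//|a h] /=; case: eqP => //; lia.
have -> : (i == 0) = false by lia.
rewrite level_after_rise //.
move: (path_word _ w) => h h0 /=; rewrite eqxx find_cat has_nseq ltnn andbF size_nseq.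
(* For [i = k] the cap alone yields the rise. Otherwise the level is still [l], so [h] is empty or
   starts with at most [l], and the search stops right after the block. *)
case: (i =P k) h0 => [<-|ik' h0]; first lia.
suff -> : find (leq^~ l) h = 0 by lia.
by case: h h0 => //= a h; rewrite addn0 => ->.
Qed.

(** The word determines the rise of the first step, and the rise determines the step. *)
Lemma path_word_inj (s k x l : nat) (w w' : seq (nat * nat)) : 0 < k ->
  x + l * k <= s ->
  gdyck_paths_from s k (x, x + l * k) w -> gdyck_paths_from s k (x, x + l * k) w' ->
  path_word l w = path_word l w' -> w = w'.
Proof.
move=> k_gt0.
(* The empty path sits at level 0, where [E_k] is impossible; any other step writes a letter. *)
have nilP y m v u : gdyck_paths_from s k (y, y + m * k) [::] ->
    gdyck_paths_from s k (y, y + m * k) (v :: u) -> [::] = path_word m (v :: u) -> False.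
  move=> [_ _ /= [-> ms]] /gdyck_paths_from_cons[stepv /andP[pv _ _]].
  case: (gdyck_step_level k_gt0 stepv pv) => [m_gt0|i ik] /=; first nia.
  by have -> : (i == 0) = false by lia.
elim: w w' x l => [|v w IHw] [|v' w'] x l xs pw pw' eqw //.
- by case: (nilP _ _ _ _ pw pw' eqw).
- by case: (nilP _ _ _ _ pw' pw (esym eqw)).
have v2 : v.2 = v'.2.
  by rewrite -(next_rise_path_word k_gt0 xs pw) eqw (next_rise_path_word k_gt0 xs pw').
move/gdyck_paths_from_cons: pw v2 eqw => [stepv /andP[pv]].
move/gdyck_paths_from_cons: pw' => [stepv' /andP[pv']].
case: (gdyck_step_level k_gt0 stepv pv) => [l_gt0|i ik];
  case: (gdyck_step_level k_gt0 stepv' pv') => [l_gt0'|i' ik'] /= ys' pw' ys pw v2 eqw.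
- by congr cons; apply: IHw pw pw' eqw.
- lia.
- lia.
subst i'; congr cons.
move: eqw; have -> : (i == 0) = false by lia.
rewrite level_after_rise //.
by move=> [/eqP]; rewrite eqseq_cat // eqxx => /eqP; apply: IHw pw pw'.
Qed.

Lemma next_rise_block (k l : nat) (h : seq nat) : 0 < k ->
  nth 0 h 0 = l -> h != [::] -> height_suffixes k l h ->
  exists i h', [/\ 0 < i <= k, height_suffixes k (l + (i == k)) h' &
    h = l :: nseq i.-1 l.+1 ++ h'].
Proof.
move=> k_gt0; case: h => //= a h -> _ [_ hP].
pose i := (minn k.-1 (find (leq^~ l) h)).+1.
have hi j : nth 0 h j = nth 0 (l :: h) j.+1 by [].
have ik : 0 < i <= k by rewrite /i; lia.
exists i, (drop i.-1 h); split=> //.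
  split=> [|b c cb]; rewrite !nth_drop; last by rewrite !hi; apply: hP; lia.
  (* At the cap, the rest starts at distance [k] from the letter [l], so with at most [l + 1];
     otherwise it starts where the search stopped. *)
  rewrite addn0; case: (i =P k) => [ik'|ik'].
    by rewrite hi; have := hP i.-1.+1 0; rewrite /=; lia.
  have -> : i.-1 = find (leq^~ l) h by move: ik'; rewrite /i; lia.
  rewrite addn0; have [hasl|] := boolP (has (leq^~ l) h).
    by have := nth_find 0 hasl.
  by move/hasNfind => ->; rewrite nth_default.
congr cons; rewrite -[LHS](cat_take_drop i.-1); congr cat.
have ih : i.-1 <= size h by have := find_size (leq^~ l) h; rewrite /i; lia.
apply: (@eq_from_nth _ 0); first by rewrite size_takel // size_nseq.
rewrite size_takel // => j ji; rewrite nth_take // nth_nseq ji.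
have jfind : j < find (leq^~ l) h by move: ji; rewrite /i; lia.
by have := before_find 0 jfind; have := hP j.+1 0; rewrite /=; lia.
Qed.

Lemma path_word_surj (s k x l : nat) (h : seq nat) : 0 < k ->
  x + l * k + size h = s -> height_suffixes k l h ->
  exists2 w, gdyck_paths_from s k (x, x + l * k) w & path_word l w = h.
Proof.
(* [E_k] keeps the word and lowers [l]; a rise removes a letter or more but may raise [l] by one,
   hence the double weight of the length. *)
move=> k_gt0; move: {2}(_ + _).+1 (ltnSn ((size h).*2 + l)) => n.
elim: n x l h => // n IHn x l h hn sE hP.
have [hl|lh] := ltnP (nth 0 h 0) l.
  have [|||w wP wh] := IHn (x + k) l.-1 h.
  - lia.
  - by case: l hl {hn hP} sE => // l _; rewrite mulSn /=; lia.
  - by case: hP; split=> //; lia.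
  exists ((k, 0) :: w) => //; apply/gdyck_paths_from_cons.
  have -> : translate (x, x + l * k) (k, 0) = (x + k, x + k + l.-1 * k).
    rewrite /translate; congr pair.
    by case: l hl {hn hP wP wh sE} => //= l _; rewrite mulSn; lia.
  split=> //=; first by constructor 2.
  by case: l hl sE {hn hP wP wh} => // l _; rewrite mulSn /=; lia.
have hl : nth 0 h 0 = l by case: hP; lia.
have [h0|h0] := eqVneq h [::].
  subst h; move: hl sE => /= <-; rewrite mul0n !addn0 => <-.
  by exists [::].
have [i [h' [ik hP' hE]]] := next_rise_block k_gt0 hl h0 hP.
have sh : size h = i + size h' by rewrite hE /= size_cat size_nseq; lia.
pose d := if i == k then 0 else i.
have dE : d + (i == k) * k = i by rewrite /d; case: eqP; lia.
have [|||w wP wh] := IHn (x + d) (l + (i == k)) h' => //.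
- by rewrite sh in hn; case: eqP; lia.
- by rewrite mulnDl; lia.
exists ((d, i) :: w).
  apply/gdyck_paths_from_cons.
  have -> : translate (x, x + l * k) (d, i) = (x + d, x + d + (l + (i == k)) * k).
    by rewrite /translate mulnDl; congr pair; rewrite /=; lia.
  split=> //=; last by rewrite mulnDl; lia.
  rewrite /d; case: eqP => [->|ik']; first by constructor 1.
  by constructor 3; exists i => //; lia.
rewrite hE /= -wh; have -> : (i == 0) = false by lia.
by rewrite level_after_rise.
Qed.

Lemma card_gdyck_paths (s k : nat) : 0 < k -> gdyck_paths s k #= height_words s k.
Proof.
move=> k_gt0.
have -> : height_words s k = path_word 0 @` gdyck_paths s k.
  apply/seteqP; split=> [h [hs h0 hP]|_ [w wP <-]].
    have [||w wP wh] := @path_word_surj s k 0 0 h k_gt0.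
    - by rewrite mul0n.
    - by split; rewrite ?h0.
    by exists w.
  have [//|sz [h0 hP]] := @path_word_suffix s k 0 0 w k_gt0 _ wP.
  by split=> //; [rewrite sz mul0n subn0|lia].
apply/card_esym/inj_card_eq => w w'; rewrite !inE => wP wP'.
exact: (@path_word_inj s k 0 0).
Qed.

(** * Cores and subtraction-closed sets *)

Lemma cells_cons (a : nat) (la : seq nat) :
  cells (a :: la) =
    [seq (x, 0) | x <- iota 0 a] ++ [seq (d.1, d.2.+1) | d <- cells la].
Proof.
rewrite /cells /= map_flatten -map_comp; congr (_ ++ flatten _).
rewrite (iotaDl 1 0) -map_comp; apply: eq_map => y /=.
by rewrite -map_comp.
Qed.

Lemma count_leq_iota (x a : nat) : count (leq x) (iota 0 a) = a - x.
Proof.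
elim: a => [|a IHa] //.
by rewrite -addn1 iotaD count_cat IHa /= add0n addn0; lia.
Qed.

Lemma count_cells_column (la : seq nat) (x : nat) :
  count (fun d => d.1 == x) (cells la) = count (ltn x) la.
Proof.
elim: la => //= a la IHla; rewrite cells_cons count_cat !count_map -IHla.
congr (_ + _).
rewrite (eq_count (a2 := pred1 x)) // count_uniq_mem ?iota_uniq //.
by rewrite mem_iota.
Qed.

Lemma hook_length_cons0 (a x : nat) (la : seq nat) :
  hook_length (a :: la) (x, 0) = a - x + count (ltn x) la.
Proof.
rewrite /hook_length cells_cons count_cat !count_map -count_leq_iota.
rewrite -count_cells_column; congr (_ + _); apply: eq_count => d /=.
  by rewrite andbT orb_idl // => /eqP ->.
by rewrite andbT orbF.
Qed.

(** Hooks extend only north and east, so a new bottom row does not affect those above it. *)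
Lemma hook_length_consS (a x y : nat) (la : seq nat) :
  hook_length (a :: la) (x, y.+1) = hook_length la (x, y).
Proof.
rewrite /hook_length cells_cons count_cat !count_map.
rewrite (eq_count (a2 := pred0)) ?count_pred0; first exact: eq_count.
by move=> d /=; rewrite andbF.
Qed.

Lemma is_core_cons (t a : nat) (la : seq nat) :
  is_core t (a :: la) <->
  is_core t la /\ forall x, x < a -> ~~ (t %| a - x + count (ltn x) la).
Proof.
split=> [core|[core core0] c].
  split=> [[x y] xy|x xa]; rewrite -(hook_length_consS a, hook_length_cons0).
    by apply: core; rewrite cells_cons mem_cat orbC (map_f (fun d => (d.1, d.2.+1)) xy).
  by apply: core; rewrite cells_cons mem_cat map_f // mem_iota.
rewrite cells_cons mem_cat => /orP[/mapP[x]|/mapP[[x y] xy ->]].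
  by rewrite mem_iota => xa ->; rewrite hook_length_cons0 core0.
by rewrite hook_length_consS core.
Qed.

(* For a partition, these are the hook lengths of the cells in the first column. *)
Fixpoint beta_numbers (la : seq nat) : seq nat :=
  if la is a :: la' then a + size la' :: beta_numbers la' else [::].

Lemma beta_numbers_inj : injective beta_numbers.
Proof.
elim=> [|a la IHla] [|b lb] //= [] + /[dup] eqb /IHla eql.
by rewrite eql => /addIn ->.
Qed.

Lemma geq_trans : transitive geq.
Proof. by move=> b a c ab bc; apply: leq_trans bc ab. Qed.

Lemma beta_numbers_lt (a : nat) (la : seq nat) :
  path geq a la -> all (gtn (a + size la)) (beta_numbers la).
Proof.
elim: la a => //= b la IHla a /andP[ab /IHla /allP bP].
apply/andP; split; first by move: ab => /=; lia.
by apply/allP => x /bP /=; move: ab => /=; lia.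
Qed.

Lemma sorted_beta_numbers (la : seq nat) :
  sorted geq la -> sorted gtn (beta_numbers la).
Proof.
elim: la => //= a la IHla /[dup] /path_sorted/IHla sla /beta_numbers_lt.
by case: (beta_numbers la) sla => //= b lb -> /andP[-> _].
Qed.

(* The map [x |-> x + count (leq^~ x) la] enumerates the complement. *)
Lemma notin_beta_numbers (la : seq nat) (j : nat) : sorted geq la ->
  j \notin beta_numbers la <-> exists x, j = x + count (leq^~ x) la.
Proof.
elim: la j => [|a la IHla] j /=.
  by move=> _; split=> // _; exists j; rewrite addn0.
move=> ala; have IH := IHla^~ (path_sorted ala).
have la_le x : a <= x -> count (leq^~ x) la = size la.
  move=> ax; apply/eqP; rewrite -all_count.
  by apply: sub_all (order_path_min geq_trans ala) => b /= ; lia.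
rewrite inE negb_or; split=> [/andP[ja /IH[x jE]]|[x ->]].
  have [xa|ax] := ltnP x a; first by exists x; rewrite leqNgt xa.
  (* From [a] on, the new part shifts the enumeration by one, so the witness drops to its
     predecessor; [ja] excludes the value at [a]. *)
  case: x jE ax => [|x] jE ax.
    by move: ja; rewrite jE la_le //; case: a ax {ala la_le}; rewrite // eqxx.
  have [xa|ax'] := ltnP x a; first by move: ja; rewrite jE la_le //; lia.
  by exists x; rewrite jE ax' !la_le //; lia.
have [ax|xa] := leqP a x.
  rewrite la_le //; apply/andP; split; first by lia.
  by apply/negP => /(allP (beta_numbers_lt ala)) /=; lia.
have := count_size (leq^~ x) la => cs; rewrite add0n; apply/andP; split; first lia.
by apply/IH; exists x.
Qed.

(** By induction on rows: with [b] the largest beta number, bottom-row hooks have lengths [b - j]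
    for the missing [j < b]. *)
Lemma is_core_beta_numbers (t : nat) (la : seq nat) : 0 < t -> sorted geq la ->
  is_core t la <->
  forall b, b \in beta_numbers la -> t <= b -> b - t \in beta_numbers la.
Proof.
move=> t_gt0; elim: la => [|a la IHla] //= ala.
have {}IHla := IHla (path_sorted ala).
have betaP := notin_beta_numbers _ (path_sorted ala).
have beta_lt := allP (beta_numbers_lt ala).
have hookE x : x < a ->
    a - x + count (ltn x) la = a + size la - (x + count (leq^~ x) la).
  move=> xa; rewrite -(count_predC (leq^~ x) la).
  rewrite (eq_count (a1 := ltn x) (a2 := predC (leq^~ x))); first by lia.
  by move=> p /=; lia.
split=> [/is_core_cons[/IHla closed core0] b|closed].
  rewrite inE => /predU1P[-> tb|bla tb]; last by rewrite inE closed // orbT.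
  (* If [b - t] were missing, the hook at its column [x] would have length exactly [t]. *)
  rewrite inE; apply/orP; right; apply: contraT => /betaP[x xE].
  have cs := count_size (leq^~ x) la.
  have xa : x < a.
    rewrite ltnNge; apply/negP => ax; suff : count (leq^~ x) la = size la by lia.
    apply/eqP; rewrite -all_count.
    by apply: sub_all (order_path_min geq_trans ala) => p /=; lia.
  by have := core0 _ xa; rewrite hookE // -xE subKn // dvdnn.
have closed' b : b \in beta_numbers la -> t <= b -> b - t \in beta_numbers la.
  move=> bla tb; have := closed b; rewrite !inE bla orbT => /(_ isT tb).
  by case/predU1P => // bt; have := beta_lt b bla => /=; lia.
apply/is_core_cons; split=> [|x xa]; first exact/IHla.
rewrite hookE //; apply/negP => /dvdnP[m mE].
have /betaP : exists y, x + count (leq^~ x) la = y + count (leq^~ y) la by exists x.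
have jlt : x + count (leq^~ x) la < a + size la.
  by have := count_size (leq^~ x) la; lia.
move/negP; apply; move: (x + _) mE jlt => j mE jlt.
(* A hook of length [m * t] makes [j] reachable from the largest beta number by [m] subtractions of
   [t]. *)
have {mE jlt} : j + m * t = a + size la /\ 0 < m by case: m mE; lia.
elim: m j => [j []//|[|m] IHm] j [mE _].
  have := closed (a + size la); rewrite inE eqxx -mE mul1n leq_addl addnK.
  by move/(_ isT isT); rewrite inE => /predU1P[|//]; lia.
rewrite -(addnK t j); apply: closed' (leq_addl _ _); apply: IHm; split=> //.
by rewrite -mE (mulSn m.+1) addnA.
Qed.

Lemma beta_numbers_notin0 (la : seq nat) : 0 \notin la -> 0 \notin beta_numbers la.
Proof.
elim: la => //= a la IHla; rewrite !inE !negb_or => /andP[a_gt0 /IHla ->].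
by rewrite andbT; lia.
Qed.

(** Each part is its entry minus the number of later entries; strict decrease makes the parts weakly
    decreasing. *)
Lemma beta_numbers_surj (bs : seq nat) : sorted gtn bs -> 0 \notin bs ->
  exists2 la, is_partition la & beta_numbers la = bs.
Proof.
elim: bs => [|b bs IHbs]; first by exists [::].
move=> sbs; rewrite inE negb_or => /andP[b_gt0 /(IHbs (path_sorted sbs))].
move=> [la [sla la0] laE]; exists (b - size la :: la).
  case: la sla la0 laE => [|c la] sla la0 laE.
    by split=> //=; rewrite subn0 mem_seq1.
  move: sbs; rewrite -laE /= => /andP[cb _].
  split; first by rewrite /= in sla *; rewrite sla andbT; lia.
  by rewrite inE negb_or la0 andbT; move: la0; rewrite inE /=; lia.
rewrite /= laE; congr cons; case: la laE {sla la0} => [|c la] laE.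
  by rewrite /=; lia.
by move: sbs; rewrite -laE /=; lia.
Qed.

Lemma sub_closed_beta_numbers (S : set nat) (la : seq nat) : ~ S 0 ->
  simultaneous_cores S la -> sub_closed S [set` beta_numbers la].
Proof.
move=> S0 [[sla la0] core]; split=> [|b t /= bla St tb].
  by apply/negP/beta_numbers_notin0.
have t_gt0 : 0 < t by case: t St {tb}.
exact: (is_core_beta_numbers t_gt0 sla).1 (core t St) b bla tb.
Qed.

Lemma sub_closed_interval_beta_numbers (s k : nat) (I : set nat) :
  0 < s -> 0 < k -> sub_closed [set t | s <= t <= s + k] I ->
  exists2 la, simultaneous_cores [set t | s <= t <= s + k] la &
    [set` beta_numbers la] = I.
Proof.
move=> s_gt0 k_gt0 clI.
(* All elements of [I] are below [s * s]; [rev] lists them in decreasing order. *)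
pose bs := rev [seq n <- iota 0 (s * s) | `[< I n >]].
have bsE n : (n \in bs) = `[< I n >].
  rewrite mem_rev mem_filter mem_iota andb_idr // => /asboolP In.
  have := sub_closed_interval_bounded s_gt0 k_gt0 clI In.
  by rewrite ltn_divLR.
have [||la [sla la0] laE] := @beta_numbers_surj bs.
- by rewrite rev_sorted sorted_filter ?iota_ltn_sorted //; apply: ltn_trans.
- by rewrite bsE; apply/asboolP/clI.1.
exists la; last by apply/predeqP => n; rewrite /= laE bsE; split=> /asboolP.
split=> // t /= st; have t_gt0 : 0 < t by lia.
apply/(is_core_beta_numbers t_gt0 sla) => b; rewrite laE !bsE => /asboolP Ib tb.
exact/asboolP/clI.2.
Qed.

Lemma card_simultaneous_cores (s k : nat) : 0 < s -> 0 < k ->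
  simultaneous_cores [set t | s <= t <= s + k] #=
  sub_closed [set t | s <= t <= s + k].
Proof.
move=> s_gt0 k_gt0.
have -> : sub_closed [set t | s <= t <= s + k] =
    (fun la => [set` beta_numbers la]) @`
      simultaneous_cores [set t | s <= t <= s + k].
  apply/seteqP; split=> [I /(sub_closed_interval_beta_numbers s_gt0 k_gt0)[la]|].
    by exists la.
  by move=> _ [la coreP <-]; apply: sub_closed_beta_numbers => //=; lia.
apply/card_esym/inj_card_eq => la la'; rewrite !inE => -[[sla _] _] [[sla' _] _] eqI.
(* Strictly decreasing lists are determined by their sets of entries. *)
apply: beta_numbers_inj; apply: (@irr_sorted_eq _ gtn).
- by move=> b a c ab bc; apply: ltn_trans bc ab.
- exact: ltnn.
- exact: sorted_beta_numbers.
- exact: sorted_beta_numbers.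
move=> n; have := congr1 (fun I : set nat => I n) eqI => /= nE.
by apply/idP/idP; rewrite nE.
Qed.

Theorem theorem4p2 (s k : nat) (hs : 1 <= s) (hk : 1 <= k) :
  exists n : nat,
    [/\ simultaneous_cores [set t | s <= t <= s + k] #= `I_n,
        gdyck_paths s k #= `I_n
      & lower_ideals [set t | s <= t <= s + k] #= `I_n].
Proof.
have [n words_n] := finite_height_words s hk.
have closed_n := card_eq_trans (card_sub_closed hs hk) words_n.
exists n; split.
- exact: card_eq_trans (card_simultaneous_cores hs hk) closed_n.
- exact: card_eq_trans (card_gdyck_paths s hk) words_n.
- by rewrite lower_ideals_sub_closed //=; lia.
Qed.
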